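(* Let $0\le\ell_p\le\infty$ for each prime $p$. Then $\widehat{Q_{(\ell_p)}/\mathbb{Z}}$ equipped with multiplication by the identity character is isomorphic as a topological dynamical system to the odometer $$\mathcal{O}_{(\ell_p)}=\varprojlim_{k}\ \mathbb{Z}\Big/\prod_{p\le k}p^{\min(k,\ell_p)}\mathbb{Z}.$$
   Context: $Q_{(\ell_p)}$ is the group of $q\in\mathbb{Q}$ for which there exist primes $p_1,\dots,p_t$ with $p_1\cdots p_tq\in\mathbb{Z}$ and $|\{1\le i\le t:p_i=p\}|\le\ell_p$ for every prime $p$; note $\mathbb{Z}\subseteq Q_{(\ell_p)}$. $\widehat{G}$ denotes the (compact) group of characters $G\to S^1$ of a discrete abelian group $G$ with the topology of pointwise convergence. The identity character of $Q_{(\ell_p)}/\mathbb{Z}$ is $r+\mathbb{Z}\mapsto e^{2\pi ir}$. The product in the odometer is over primes $p\le k$, and the odometer carries the homeomorphism of coordinatewise addition of $1$. *)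

(* Defs.v *)
From HB Require Import structures.
From mathcomp Require Import all_boot all_order all_algebra.
From mathcomp Require Import ring_quotient complex.
From mathcomp Require Import all_classical all_reals all_analysis.

Set Implicit Arguments.
Unset Strict Implicit.
Unset Printing Implicit Defensive.

Import Order.TTheory GRing.Theory Num.Theory.
Import numFieldNormedType.Exports.
Import Quotient.

Local Open Scope classical_set_scope.
Local Open Scope ring_scope.
Local Open Scope complex_scope.
Local Open Scope quotient_scope.

(* Exponents in {0, 1, 2, ...} U {oo} are encoded in [option nat], with [None]
   standing for oo. A sequence (l_p) indexed by the primes is a function
   [l : nat -> option nat] whose values at non-primes are never used. *)
Definition leq_ext (n : nat) (e : option nat) : bool :=
  if e is Some m then (n <= m)%N else true.

Definition minn_ext (k : nat) (e : option nat) : nat :=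
  if e is Some m then minn k m else k.

Definition homeomorphism (X Y : topologicalType) (f : X -> Y) : Prop :=
  continuous f /\
  exists g : Y -> X, [/\ cancel f g, cancel g f & continuous g].

Record dynamical_system : Type := DynamicalSystem {
  ds_space : topologicalType;
  ds_map : ds_space -> ds_space;
  ds_compact : compact [set: ds_space];
  ds_hausdorff : hausdorff_space ds_space;
  ds_homeo : homeomorphism ds_map }.

Definition ds_isomorphic (X Y : dynamical_system) : Prop :=
  exists2 h : ds_space X -> ds_space Y,
    homeomorphism h & forall x, h (ds_map x) = ds_map (h x).

Section Topology.

Lemma subtype_continuous (X Y : topologicalType) (A : set X) (f : Y -> A) :
  continuous (set_val \o f) -> continuous f.
Proof.
move=> /continuousP cf; apply/continuousP => _ [V oV <-].
exact: (cf V oV).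
Qed.

Lemma subtype_compact (X : topologicalType) (A : set X) :
  compact A -> compact [set: A].
Proof.
move=> cA F PF _.
have [] := cA ((@set_val X A) @ F) _.
  by apply: (@filterS _ F _ setT) filterT => x _ /=; exact: set_valP.
move=> a [Aa ca]; exists (exist _ a (mem_set Aa)); split=> //.
move=> P U FP [_ [[V oV <-] Va VU]].
have [||_ [[z Pz <-] Vz]] := ca ((@set_val X A) @` P) V.
- by apply: (@filterS _ F _ P) FP => z Pz /=; exists z.
- by apply: open_nbhs_nbhs; split.
by exists z; split => //; exact: VU.
Qed.

Lemma subtype_hausdorff (X : topologicalType) (A : set X) :
  hausdorff_space X -> hausdorff_space A.
Proof.
move=> hX p q pq; apply/val_inj/hX => P U nP nU.
have cv := @initial_continuous A X set_val.
by have [z [Pz Uz]] := pq _ _ (cv p P nP) (cv q U nU); exists (set_val z).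
Qed.

Lemma prod_continuous (I : Type) (T : I -> topologicalType)
    (Y : topologicalType) (f : Y -> prod_topology T) :
  (forall i, continuous (fun y => f y i)) -> continuous f.
Proof.
move=> cf y; apply/cvg_sup => i U [_ [[V oV <-] Vx VU]].
apply: (@filterS _ (nbhs y) _ (fun z => V (f z i))); first by move=> z; exact: VU.
by apply: cf; apply: open_nbhs_nbhs.
Qed.

Lemma discrete_continuous (X : discreteTopologicalType) (Y : topologicalType)
  (f : X -> Y) : continuous f.
Proof.
by move=> x U /nbhs_singleton Ufx; rewrite nbhs_principalE; apply/principal_filterP.
Qed.

Lemma closed_eqfun (X Y : topologicalType) (f g : X -> Y) :
  hausdorff_space Y -> continuous f -> continuous g ->
  closed [set x | f x = g x].
Proof.
move=> hY cf cg x clx; apply: hY => P U nP nU.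
have [z [/= fgz [Pz Uz]]] := clx _ (@filterI _ (nbhs x) _ _ _ (cf x P nP) (cg x U nU)).
by exists (f z); split => //; rewrite fgz.
Qed.

End Topology.

Definition inQ (l : nat -> option nat) (q : rat) : Prop :=
  exists ps : seq nat,
    [/\ forall p, p \in ps -> prime p,
        (\prod_(p <- ps) p)%:R * q \is a Num.int &
        forall p, prime p -> leq_ext (count_mem p ps) (l p)].

Definition Qpred (l : nat -> option nat) : {pred rat} := fun q => `[< inQ l q >].

Section QGroup.
Variable l : nat -> option nat.

Lemma logn_prod_primes (ps : seq nat) (p : nat) :
  (forall p, p \in ps -> prime p) -> prime p ->
  ((0 < \prod_(p <- ps) p) /\ logn p (\prod_(p <- ps) p) = count_mem p ps)%N.
Proof.
move=> + pp; elim: ps => [|q ps IH] psP; first by rewrite big_nil logn1.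
have qP : prime q by apply: psP; rewrite mem_head.
have [D0 E] := IH (fun r rps => psP r (@mem_behead _ (q :: ps) r rps)).
rewrite big_cons muln_gt0 prime_gt0//; split => //.
by rewrite (lognM _ (prime_gt0 qP) D0) E (logn_prime _ qP) eq_sym.
Qed.

Lemma prime_factors (n : nat) : (0 < n)%N ->
  exists2 ps : seq nat, (forall p, p \in ps -> prime p) & n = (\prod_(p <- ps) p)%N.
Proof.
elim/ltn_ind: n => n IH n0; case: (ltngtP n 1%N) => [|n1|->].
- by rewrite ltnNge n0.
- have pP := pdiv_prime n1; have dv := pdiv_dvd n.
  have [||ps psP E] := IH (n %/ pdiv n)%N.
  + by rewrite ltn_Pdiv// prime_gt1.
  + by rewrite divn_gt0 ?pdiv_gt0// dvdn_leq.
  exists (pdiv n :: ps); first by move=> p; rewrite inE => /predU1P[->|/psP].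
  by rewrite big_cons -E mulnC divnK.
- by exists [::] => //; rewrite big_nil.
Qed.

Lemma inQP (q : rat) : inQ l q <-> exists D : nat,
  [/\ (0 < D)%N, D%:R * q \is a Num.int &
      forall p, prime p -> leq_ext (logn p D) (l p)].
Proof.
split=> [[ps [psP qI cnt]]|[D [D0 qI cnt]]].
  exists (\prod_(p <- ps) p)%N; split => //.
    by have [] := @logn_prod_primes ps 2%N psP isT.
  by move=> p pp; have [_ ->] := logn_prod_primes psP pp; exact: cnt.
have [ps psP E] := prime_factors D0; exists ps; split => //.
- by rewrite -E.
- by move=> p pp; have [_ <-] := logn_prod_primes psP pp; rewrite -E; exact: cnt.
Qed.

Lemma Qpred_zmod_closed : zmod_closed (Qpred l).
Proof.
split=> [|x y /asboolP/inQP[D [D0 xI HD]] /asboolP/inQP[E [E0 yI HE]]].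
  apply/asboolP/inQP; exists 1%N; rewrite mulr0; split => // p _.
  by rewrite logn1; case: (l p).
apply/asboolP/inQP; exists (lcmn D E); split.
- by rewrite lcmn_gt0 D0.
- rewrite mulrBr; apply: rpredB.
  + by rewrite -(divnK (dvdn_lcml D E)) natrM -mulrA rpredM// rpred_nat.
  + by rewrite -(divnK (dvdn_lcmr D E)) natrM -mulrA rpredM// rpred_nat.
- move=> p pp; have := HD p pp; have := HE p pp; rewrite logn_lcm//.
  by case: (l p) => //= m ? ?; rewrite geq_max; apply/andP.
Qed.

HB.instance Definition _ := GRing.isZmodClosed.Build rat (Qpred l)
  Qpred_zmod_closed.

Record Qgroup : Type := MkQgroup { Qval : rat; _ : Qval \in Qpred l }.

HB.instance Definition _ := [isSub for Qval].
HB.instance Definition _ := [Choice of Qgroup by <:].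
HB.instance Definition _ := [SubChoice_isSubZmodule of Qgroup by <:].

Definition Zpred : {pred Qgroup} := fun x => Qval x \is a Num.int.

Lemma Zpred_zmod_closed : zmod_closed Zpred.
Proof.
split=> [|x y xI yI]; rewrite unfold_in; first exact: rpred0.
exact: rpredB.
Qed.

HB.instance Definition _ := GRing.isZmodClosed.Build Qgroup Zpred
  Zpred_zmod_closed.

Lemma int_inQ (q : rat) : q \is a Num.int -> q \in Qpred l.
Proof.
move=> qI; apply/asboolP/inQP; exists 1%N; rewrite mul1r; split => // p _.
by rewrite logn1; case: (l p).
Qed.

Definition QmodZ : zmodType := quot (GRing.ZmodClosed.clone Qgroup Zpred _).

End QGroup.

(* [R[i]] carries the topology of its norm only when seen as a [numFieldType]. *)
Notation Cplx R := (R[i] : numFieldType).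

(* The characters of the discrete group G, i.e. the homomorphisms from G to the
   unit circle of the complex plane; [{ptws _ -> _}] has the topology of
   pointwise convergence, and sets, seen as types, the subspace topology. *)
Definition characters (R : realType) (G : zmodType) : set {ptws G -> Cplx R} :=
  [set chi | (forall x, `|chi x| = 1) /\ {morph chi : x y / x + y >-> x * y}].

Arguments characters R G : clear implicits.

Definition dual (R : realType) (G : zmodType) : topologicalType :=
  characters R G.

Definition Character (R : realType) (G : zmodType) (chi : {ptws G -> Cplx R})
    (chiP : characters R G chi) : dual R G :=
  exist (fun chi => chi \in characters R G) chi (mem_set chiP).

Section Dual.
Variables (R : realType) (G : zmodType).

Lemma real_complex_continuous : continuous (fun x : R => x%:C : Cplx R).
Proof.
move=> x; apply/cvgrPdist_lt => e e0.
have [er er0 ->] : exists2 er : R, 0 < er & e = er%:C.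
  by case: e e0 => a b; rewrite ltcE /= => /andP[/eqP -> a0]; exists a.
near=> y.
rewrite -rmorphB normc_def /= expr0n /= addr0 sqrtr_sqr ltcR.
by near: y; apply: cvgr_dist_lt.
Unshelve. all: by end_near. Qed.

Lemma circle_compact : compact [set z : Cplx R | `|z| = 1].
Proof.
pose f (p : R * R) : Cplx R := p.1%:C + 'i%C * p.2%:C.
have cf : continuous f.
  move=> p; apply: cvgD; last apply: cvgM; first last.
  - apply: (@continuous_comp _ _ _ (@snd R R) (fun x => x%:C : Cplx R)).
      exact: cvg_snd.
    exact: real_complex_continuous.
  - exact: cvg_cst.
  - apply: (@continuous_comp _ _ _ (@fst R R) (fun x => x%:C : Cplx R)).
      exact: cvg_fst.
    exact: real_complex_continuous.
have cb : compact (`[(-1 : R), 1] `*` `[(-1 : R), 1]).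
  by apply: compact_setX; exact: segment_compact.
apply: (@subclosed_compact _ _ (f @` (`[(-1 : R), 1] `*` `[(-1 : R), 1]))).
- apply: (@closed_eqfun (Cplx R) (Cplx R) (fun z => `|z|) (fun=> 1)).
  + exact: norm_hausdorff.
  + exact: norm_continuous.
  + exact: cst_continuous.
- by apply: continuous_compact => //; exact: continuous_subspaceT.
move=> z /= z1; exists (complex.Re z, complex.Im z); last by rewrite /f /= -complexE.
have := add_Re2_Im2 z; rewrite z1 expr1n => -[E].
by split; rewrite /= in_itv /= -ler_norml -(ler_pXn2r (n := 2)) ?nnegrE// expr1n
  real_normK ?num_real// -E ?lerDl ?lerDr sqr_ge0.
Qed.

Lemma dual_compact : compact [set: dual R G].
Proof.
apply: subtype_compact.
pose B : set {ptws G -> Cplx R} :=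
  \bigcap_x \bigcap_y [set chi | chi (x + y) = chi x * chi y].
have pc (x : G) : continuous (fun chi : {ptws G -> Cplx R} => chi x).
  exact: (@proj_continuous G (fun=> Cplx R) x).
have clB : closed B.
  apply: closed_bigI => x _; apply: closed_bigI => y _.
  apply: (@closed_eqfun {ptws G -> Cplx R} (Cplx R) (fun chi => chi (x + y))
    (fun chi => chi x * chi y)).
  - exact: norm_hausdorff.
  - exact: pc.
  - move=> chi.
    have := @cvgM (Cplx R) _ (nbhs chi) _ (fun c : {ptws G -> Cplx R} => c x)
      (fun c => c y) (chi x) (chi y) (pc x chi) (pc y chi).
    exact.
have cT := @tychonoff G (fun=> Cplx R) (fun=> [set z | `|z| = 1])
  (fun=> circle_compact).
apply: (subclosed_compact _ cT) => [|chi [] //].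
rewrite (_ : characters R G =
  [set chi : {ptws G -> Cplx R} | forall x, `|chi x| = 1] `&` B).
  apply: closedI => //; apply: compact_closed cT.
  by apply: hausdorff_product => x; exact: norm_hausdorff.
apply/seteqP; split=> [chi [n1 hm]|chi [n1 hm]]; split => //.
- by move=> x _ y _; exact: hm.
- by move=> x y; exact: hm.
Qed.

Lemma dual_hausdorff : hausdorff_space (dual R G).
Proof.
apply: subtype_hausdorff; apply: hausdorff_product => x.
exact: norm_hausdorff.
Qed.

Lemma dual_norm (chi : dual R G) x : `|set_val chi x| = 1.
Proof. by have [+ _] := set_valP chi; exact. Qed.

Lemma dual_morph (chi : dual R G) x y :
  set_val chi (x + y) = set_val chi x * set_val chi y.
Proof. by have [_ +] := set_valP chi; exact. Qed.

Lemma mulchar_subproof (chi psi : dual R G) :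
  characters R G (fun x => set_val chi x * set_val psi x).
Proof.
split=> [x|x y] /=; last by rewrite !dual_morph mulrACA.
by rewrite normrM !dual_norm mulr1.
Qed.

Definition mulchar (chi psi : dual R G) : dual R G :=
  Character (mulchar_subproof chi psi).

Lemma mulcharE (chi psi : dual R G) x :
  set_val (mulchar chi psi) x = set_val chi x * set_val psi x.
Proof. by []. Qed.

Lemma invchar_subproof (chi : dual R G) :
  characters R G (fun x => (set_val chi x)^-1).
Proof.
split=> [x|x y] /=; last by rewrite dual_morph invfM.
by rewrite normfV dual_norm invr1.
Qed.

Definition invchar (chi : dual R G) : dual R G :=
  Character (invchar_subproof chi).

Lemma eval_continuous (x : G) :
  continuous (fun chi : dual R G => set_val chi x : Cplx R).
Proof.
move=> chi; apply: (@continuous_comp (dual R G) {ptws G -> Cplx R} (Cplx R)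
  (@set_val _ _) (fun f => f x)).
  exact: initial_continuous.
exact: (@proj_continuous G (fun=> Cplx R) x).
Qed.

Lemma mulchar_continuous (chi : dual R G) : continuous (mulchar chi).
Proof.
apply: subtype_continuous; apply: prod_continuous => x psi.
have := (@cvgM (Cplx R) _ (nbhs psi) _ (fun=> set_val chi x)
  (fun f => set_val f x) _ _ (@cst_continuous _ _ _ psi)
  (@eval_continuous x psi)).
exact.
Qed.

Lemma mulchar_homeo (chi : dual R G) : homeomorphism (mulchar chi).
Proof.
have n0 x : set_val chi x != 0.
  by rewrite -normr_eq0 dual_norm oner_neq0.
split; first exact: mulchar_continuous.
exists (mulchar (invchar chi)); split.
- by move=> psi; apply/val_inj/funext => x; rewrite /= mulKf.
- by move=> psi; apply/val_inj/funext => x; rewrite /= mulVKf.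
- exact: mulchar_continuous.
Qed.

End Dual.

(* e^{2 pi i t}, by Euler's formula. *)
Definition expi2pi (R : realType) (t : R) : Cplx R :=
  cos (2 * pi * t) +i* sin (2 * pi * t).

Section IdentityCharacter.
Variables (R : realType) (l : nat -> option nat).

Lemma expi2piD (s t : R) : expi2pi (s + t) = expi2pi s * expi2pi t.
Proof.
rewrite /expi2pi mulrDr cosD sinD; apply/eqP; rewrite eq_complex /=.
by rewrite eqxx addrC [_ * cos _]mulrC eqxx.
Qed.

Lemma norm_expi2pi (t : R) : `|expi2pi t| = 1.
Proof. by rewrite normc_def /= cos2Dsin2 sqrtr1. Qed.

Lemma expi2pi1 : expi2pi (1 : R) = 1.
Proof. by rewrite /expi2pi mulr1 mulr_natl cos2pi sin2pi. Qed.

Lemma expi2pi_nat (n : nat) : expi2pi (n%:R : R) = 1.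
Proof.
elim: n => [|n IH]; first by rewrite /expi2pi mulr0 cos0 sin0.
by rewrite -natr1 expi2piD IH expi2pi1 mulr1.
Qed.

Lemma expi2pi_int (t : R) : t \is a Num.int -> expi2pi t = 1.
Proof.
move=> /intrP[[n|n] ->]; first exact: expi2pi_nat.
have := expi2piD (- n.+1%:R) n.+1%:R.
by rewrite NegzE mulrNz addNr expi2pi_nat mulr1 => <-; exact: (expi2pi_nat 0).
Qed.

(* The identity character r + Z |-> e^{2 pi i r}; [idchar_pi] below shows that
   the choice of the representative r is irrelevant. *)
Definition idchar_fun (x : QmodZ l) : Cplx R :=
  expi2pi (ratr (Qval (repr x))).

Lemma idchar_pi (r : Qgroup l) :
  idchar_fun (\pi_(QmodZ l) r) = expi2pi (ratr (Qval r)).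
Proof.
rewrite /idchar_fun; set s := repr _.
have : s - r \in GRing.ZmodClosed.clone (Qgroup l) (@Zpred l) _.
  by rewrite idealrBE reprK.
rewrite unfold_in => /intrP[z zE].
have -> : Qval s = Qval r + z%:~R.
  by rewrite -zE -[s in LHS](subrK r) addrC; exact: (raddfD (\val : Qgroup l -> rat)).
by rewrite rmorphD /= ratr_int expi2piD (expi2pi_int (intr_int _ z)) mulr1.
Qed.

Lemma idchar_subproof : characters R (QmodZ l) idchar_fun.
Proof.
split=> [x|x y]; first exact: norm_expi2pi.
rewrite -[x]reprK -[y]reprK -[X in idchar_fun X]raddfD !idchar_pi.
by rewrite -expi2piD -rmorphD; congr (expi2pi (ratr _)); exact: (raddfD (\val : Qgroup l -> rat)).
Qed.

Definition idchar : dual R (QmodZ l) := Character idchar_subproof.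

Definition dual_system : dynamical_system :=
  DynamicalSystem (@dual_compact R (QmodZ l)) (@dual_hausdorff R (QmodZ l))
    (mulchar_homeo idchar).

End IdentityCharacter.

Section Cyclic.

(* Z/mZ with the discrete topology; unlike ['Z_m], it is trivial for m = 1. *)
Definition Zmod (m : nat) : Type :=
  quot (GRing.ZmodClosed.clone int (dvdz m%:Z) _).

HB.instance Definition _ (m : nat) := GRing.Zmodule.on (Zmod m).
HB.instance Definition _ (m : nat) := hasNbhs.Build (Zmod m) principal_filter.
HB.instance Definition _ (m : nat) := Discrete_ofNbhs.Build (Zmod m) erefl.

Definition Zclass (m : nat) (z : int) : Zmod m :=
  \pi_(quot (GRing.ZmodClosed.clone int (dvdz m%:Z) _)) z.

(* The map Z/mZ -> Z/nZ induced by the identity of Z, for n dividing m. *)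
Definition Zreduce (m n : nat) (x : Zmod m) : Zmod n := Zclass n (repr x).

Lemma ZclassD m y z : Zclass m (y + z) = Zclass m y + Zclass m z.
Proof. exact: raddfD. Qed.

Lemma Zclass0 m : Zclass m 0 = 0.
Proof. exact: raddf0. Qed.

Lemma Zclass_eq m y z : (Zclass m y == Zclass m z) = (m%:Z %| y - z)%Z.
Proof. by rewrite [RHS]idealrBE. Qed.

Lemma Zclass_repr m (x : Zmod m) : Zclass m (repr x) = x.
Proof. exact: reprK. Qed.

Lemma Zreduce_class m n z : (n %| m)%N -> Zreduce n (Zclass m z) = Zclass n z.
Proof.
move=> nm; apply/eqP; rewrite Zclass_eq.
apply: (@dvdz_trans m%:Z); first by [].
by rewrite -Zclass_eq Zclass_repr.
Qed.

Lemma ZreduceD m n (x y : Zmod m) :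
  (n %| m)%N -> Zreduce n (x + y) = Zreduce n x + Zreduce n y.
Proof.
move=> nm; rewrite -[x]Zclass_repr -[y]Zclass_repr -ZclassD.
by rewrite !Zreduce_class// ZclassD.
Qed.

Lemma Zmod_finite m : (0 < m)%N -> finite_set [set: Zmod m].
Proof.
move=> m0; apply: (@sub_finite_set _ _ ((fun i : nat => Zclass m i%:Z) @` `I_m)).
  move=> x _; exists (absz (repr x %% m%:Z)%Z).
    by rewrite /= -ltz_nat gez0_abs ?modz_ge0 ?ltz_pmod// -lt0n.
  rewrite gez0_abs ?modz_ge0 -?lt0n// -[RHS]Zclass_repr; apply/eqP.
  by rewrite Zclass_eq -eqz_mod_dvd modz_mod.
exact/finite_image/finite_II.
Qed.

End Cyclic.

Section Odometer.
Variable l : nat -> option nat.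

Definition modulus (k : nat) : nat :=
  (\prod_(0 <= p < k.+1 | prime p) p ^ minn_ext k (l p))%N.

(* The term k = 0 is the empty product 1: it adds a trivial factor Z/1Z to the
   inverse limit. *)
Definition odometer_set : set (prod_topology (fun k => Zmod (modulus k))) :=
  [set x | forall i j, (i <= j)%N -> Zreduce (modulus i) (x j) = x i].

Definition odometer : topologicalType := odometer_set.

Lemma modulus_gt0 k : (0 < modulus k)%N.
Proof. by apply: prodn_cond_gt0 => p pp; rewrite expn_gt0 prime_gt0. Qed.

Lemma dvdn_modulus i j : (i <= j)%N -> (modulus i %| modulus j)%N.
Proof.
move=> ij; rewrite /modulus [X in (_ %| X)%N](@big_cat_nat _ _ _ i.+1)//=.
apply: dvdn_mulr; elim/big_ind2: _ => // [? ? ? ?|p pp]; first exact: dvdn_mul.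
by apply: dvdn_exp2l; case: (l p) => //= m; rewrite leq_min geq_minr geq_min ij.
Qed.

Lemma odometer_compact : compact [set: odometer].
Proof.
apply: subtype_compact.
have pc (k : nat) := @proj_continuous nat (fun k => Zmod (modulus k)) k.
have cT := @tychonoff nat (fun k => Zmod (modulus k)) (fun=> setT)
  (fun k => finite_compact (Zmod_finite (modulus_gt0 k))).
apply: (subclosed_compact _ cT) => //.
rewrite (_ : odometer_set = \bigcap_i \bigcap_(j in [set j | (i <= j)%N])
    [set x | Zreduce (modulus i) (x j) = x i]).
  apply: closed_bigI => i _; apply: closed_bigI => j _.
  apply: closed_eqfun; first exact: discrete_hausdorff.
    by move=> x; apply: continuous_comp (pc j x) _; exact: discrete_continuous.
  exact: pc.
by apply/seteqP; split=> x /= h i *; apply: h.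
Qed.

Lemma odometer_hausdorff : hausdorff_space odometer.
Proof.
apply: subtype_hausdorff; apply: hausdorff_product => k.
exact: discrete_hausdorff.
Qed.

Definition Coherent (x : prod_topology (fun k => Zmod (modulus k)))
    (xP : odometer_set x) : odometer :=
  exist (fun x => x \in odometer_set) x (mem_set xP).

Lemma translate_subproof (z : int) (x : odometer) :
  odometer_set (fun k => set_val x k + Zclass (modulus k) z).
Proof.
move=> i j ij; rewrite ZreduceD ?Zreduce_class ?dvdn_modulus//.
by congr (_ + _); exact: (set_valP x).
Qed.

Definition translate (z : int) (x : odometer) : odometer :=
  Coherent (translate_subproof z x).

Lemma translate_continuous (z : int) : continuous (translate z).
Proof.
apply: subtype_continuous; apply: prod_continuous => k.
have pr_k : continuous (fun x : odometer => set_val x k).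
  move=> x; apply: (@continuous_comp odometer
    (prod_topology (fun k => Zmod (modulus k))) (Zmod (modulus k))
    (@set_val _ _) (fun f => f k)).
    exact: initial_continuous.
  exact: (@proj_continuous nat (fun k => Zmod (modulus k)) k).
move=> x; apply: (@continuous_comp odometer _ _ (fun y => set_val y k)
  (fun c => c + Zclass (modulus k) z)); first exact: pr_k.
exact: discrete_continuous.
Qed.

Lemma translate_homeo (z : int) : homeomorphism (translate z).
Proof.
split; first exact: translate_continuous.
exists (translate (- z)); split; last exact: translate_continuous.
- move=> x; apply/val_inj; apply: functional_extensionality_dep => k /=.
  by rewrite -addrA -ZclassD subrr Zclass0 addr0.
- move=> x; apply/val_inj; apply: functional_extensionality_dep => k /=.
  by rewrite -addrA -ZclassD addNr Zclass0 addr0.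
Qed.

Definition odometer_system : dynamical_system :=
  DynamicalSystem odometer_compact odometer_hausdorff (translate_homeo 1).

End Odometer.

(* Main.v *)
(* A point x = (x_k) of the odometer pairs with a class q + Z by
   <x, q> = e^{2 pi i q a}, where a is any integer representing x_k for any k
   with m_k q an integer, m_k being the k-th modulus; every q in Q_(l_p) has
   such a k. The resulting map from the odometer to the dual is continuous, and
   adding 1 to x multiplies <x, -> by the identity character. It is injective
   because <x, 1/m_k> determines x_k, and surjective because a character sends
   1/m_k to an m_k-th root of unity. By compactness it is a homeomorphism. *)
Require Import Defs.
From mathcomp Require Import all_boot all_order all_algebra.
From mathcomp Require Import lra.
From mathcomp Require Import ring_quotient complex.
From mathcomp Require Import all_classical all_reals all_analysis.

Set Implicit Arguments.
Unset Strict Implicit.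
Unset Printing Implicit Defensive.

Import Order.TTheory GRing.Theory Num.Theory.
Import numFieldNormedType.Exports.
Import Quotient.

Local Open Scope classical_set_scope.
Local Open Scope ring_scope.
Local Open Scope quotient_scope.

Lemma continuous_bij_homeo (X Y : topologicalType) (f : X -> Y) :
  compact [set: X] -> hausdorff_space Y -> continuous f ->
  injective f -> (forall y, exists x, f x = y) ->
  exists2 g : Y -> X, homeomorphism g & cancel g f.
Proof.
move=> cX hY cf injf /choice[g gK].
have fK : cancel f g by move=> x; apply: injf; rewrite gK.
exists g => //; split; last by exists f; split.
apply/continuous_closedP => A clA.
have -> : g @^-1` A = f @` A.
  apply/seteqP; split=> [y Ay|_ [x Ax <-]]; last by rewrite /preimage /= fK.
  by exists (g y).
apply: compact_closed => //; apply: continuous_compact.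
  exact: continuous_subspaceT.
exact: subclosed_compact clA cX _.
Qed.

Lemma divr_int_dvdz (F : archiRealFieldType) (a : int) (m : nat) : (0 < m)%N ->
  (a%:~R / m%:R : F) \is a Num.int = (m%:Z %| a)%Z.
Proof.
move=> m0; have mF0 : m%:R != 0 :> F by rewrite pnatr_eq0 -lt0n.
apply/intrP/dvdzP => -[q E]; exists q; last first.
  by rewrite E intrM mulfK.
by apply: (@intr_inj F); rewrite intrM -E divfK.
Qed.

(** * Kernel of the exponential and roots of unity *)

Section Circle.
Variable R : realType.

Lemma expi2piMn (t : R) (n : nat) : expi2pi (t *+ n) = expi2pi t ^+ n.
Proof.
elim: n => [|n IH]; first by rewrite mulr0n expr0 (expi2pi_nat R 0).
by rewrite mulrSr expi2piD IH exprSr.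
Qed.

Lemma expi2piMz (t : R) (z : int) : expi2pi (t *~ z) = expi2pi t ^ z.
Proof.
case: z => n; first exact: expi2piMn.
have e0 : expi2pi t ^+ n.+1 != 0.
  by rewrite expf_neq0// -normr_eq0 norm_expi2pi oner_neq0.
apply: (mulIf e0); rewrite mulVf// -expi2piMn -expi2piD NegzE mulrNz addNr.
exact: (expi2pi_nat R 0).
Qed.

(** For the fractional part [u], the real part gives [cos (2 * pi * u) = 1], so [sin (pi * u) = 0]
    by the double angle formula. As sine is positive on the open interval from 0 to [pi], this
    forces [u = 0]. *)
Lemma expi2pi_eq1 (t : R) : expi2pi t = 1 -> t \is a Num.int.
Proof.
move=> et1; pose u := t - (Num.floor t)%:~R.
have tE : t = u + (Num.floor t)%:~R by rewrite subrK.
have eu1 : expi2pi u = 1.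
  by rewrite -et1 [in RHS]tE expi2piD (expi2pi_int (intr_int R _)) mulr1.
have su0 : sin (pi * u) = 0.
  have : cos (2 * pi * u) = 1 := congr1 (@complex.Re R) eu1.
  rewrite -mulrA mulr_natl cos_mulr2n cos2sin2 => e.
  by apply/eqP; rewrite -sqrf_eq0; apply/eqP; lra.
have /andP[u0 u1] : 0 <= u < 1.
  by rewrite subr_ge0 floor_le ltrBlDl -intrD1 floorD1_gt.
have [u_eq0|un0] := eqVneq 0 u; first by rewrite tE -u_eq0 add0r intr_int.
have : 0 < sin (pi * u).
  apply: sin_gt0_pi; rewrite mulr_gt0 ?pi_gt0 ?lt_neqAle ?un0//=.
  by rewrite -lt_neqAle gtr_pMr ?pi_gt0.
by rewrite su0 ltxx.
Qed.

Lemma eq_expi2pi (s t : R) :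
  expi2pi s = expi2pi t <-> s - t \is a Num.int.
Proof.
have := expi2piD (s - t) t; rewrite subrK => ->.
split=> [/eqP|/expi2pi_int ->]; last by rewrite mul1r.
rewrite -[X in _ == X]mul1r => /eqP/mulIf e; apply/expi2pi_eq1/e.
by rewrite -normr_eq0 norm_expi2pi oner_neq0.
Qed.

Lemma expi2pi_prim_root (m : nat) : (0 < m)%N ->
  m.-primitive_root (expi2pi (m%:R^-1 : R)).
Proof.
move=> m0; rewrite /primitive_root_of_unity m0; apply/forallP => i.
rewrite unity_rootE -expi2piMn -[_ *+ _]mulr_natl; apply/eqP.
apply/eqP/eqP => [/expi2pi_eq1 e1|->].
  (* The exponents tested are [i.+1] with [i < m], so divisibility by [m] forces [i.+1 = m]. *)
  have /dvdn_leq -/(_ isT) mi : (m%:Z %| i.+1%:Z)%Z.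
    by rewrite -(divr_int_dvdz R).
  by apply/eqP; rewrite eqn_leq mi ltn_ord.
by rewrite divff ?expi2pi1// pnatr_eq0 -lt0n.
Qed.

Lemma root_of_unity_expi2pi (m : nat) (z : Cplx R) : (0 < m)%N -> z ^+ m = 1 ->
  exists a : nat, z = expi2pi (a%:R / m%:R).
Proof.
move=> m0 /(prim_rootP (expi2pi_prim_root m0))[a ->].
by exists a; rewrite -expi2piMn mulr_natl.
Qed.

End Circle.

(** * Prime factorization of the moduli *)

Section Modulus.
Variable l : nat -> option nat.

Lemma logn_prod_prime_powers (f : nat -> nat) (p n : nat) : prime p ->
  logn p (\prod_(0 <= q < n | prime q) q ^ f q)%N = if (p < n)%N then f p else 0%N.
Proof.
move=> pp; elim: n => [|n IH]; first by rewrite big_geq// logn1.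
have P0 : (0 < \prod_(0 <= q < n | prime q) q ^ f q)%N.
  by apply: prodn_cond_gt0 => q qp; rewrite expn_gt0 prime_gt0.
rewrite big_mkcond big_nat_recr//= -big_mkcond; case: ifPn => [np|nnp].
  have nf0 : (0 < n ^ f n)%N by rewrite expn_gt0 prime_gt0.
  rewrite lognM// IH lognX logn_prime// ltnS.
  by case: (ltngtP p n) => [_|_|->]; rewrite ?muln0 ?muln1 ?addn0.
rewrite muln1 IH ltnS; case: (ltngtP p n) => // pn.
by rewrite -pn pp in nnp.
Qed.

(** This bound is what puts the inverse of [modulus l k] in the group. *)
Lemma logn_modulus_leq_ext (k p : nat) : prime p ->
  leq_ext (logn p (modulus l k)) (l p).
Proof.
move=> pp; rewrite /modulus logn_prod_prime_powers//.
by case: (l p) => //= m; case: ifP; rewrite ?geq_minr.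
Qed.

(** Level [D] is large enough: the primes dividing [D] and their exponents in [D] are all at most
    [D], so the truncation in [modulus l D] cuts nothing off. *)
Lemma dvdn_modulus_of_leq_ext (D : nat) : (0 < D)%N ->
  (forall p, prime p -> leq_ext (logn p D) (l p)) -> (D %| modulus l D)%N.
Proof.
(* [D] becomes a product over all [p <= D], the range of [modulus l D], so the factors can be
   compared one by one; a nonprime [p] has exponent 0 in [D]. *)
move=> D0 Dl; rewrite -{1}(partnT D0) /partn /modulus [X in (_ %| X)%N]big_mkcond.
elim/big_ind2: _ => // [? ? ? ?|p _]; first exact: dvdn_mul.
case: ifPn => [pp|/negPf np]; last by rewrite lognE np.
apply: dvdn_exp2l; have := Dl p pp; rewrite /minn_ext /leq_ext.
have : (logn p D <= D)%N by rewrite ltnW// ltn_logl.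
by case: (l p) => [m|]//; rewrite leq_min => -> ->.
Qed.

End Modulus.

Lemma ratr_int_num (F : archiNumFieldType) (q : rat) :
  q \is a Num.int -> (ratr q : F) \is a Num.int.
Proof. by case/intrP => z ->; rewrite ratr_int intr_int. Qed.

(** * Characters on integer multiples *)

Section CharacterTheory.
Variables (R : realType) (G : zmodType) (chi : dual R G).

Lemma dual0 : set_val chi 0 = 1.
Proof.
have n0 : set_val chi 0 != 0 by rewrite -normr_eq0 dual_norm oner_neq0.
by apply: (mulIf n0); rewrite -dual_morph addr0 mul1r.
Qed.

Lemma dualMn (x : G) (n : nat) :
  set_val chi (x *+ n) = set_val chi x ^+ n.
Proof.
elim: n => [|n IH]; first by rewrite mulr0n dual0.
by rewrite mulrS dual_morph IH exprS.
Qed.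

Lemma dualN (x : G) :
  set_val chi (- x) = (set_val chi x)^-1.
Proof.
have n0 : set_val chi x != 0 by rewrite -normr_eq0 dual_norm oner_neq0.
by apply: (mulIf n0); rewrite -dual_morph addNr dual0 mulVf.
Qed.

Lemma dualMz (x : G) (z : int) :
  set_val chi (x *~ z) = set_val chi x ^ z.
Proof.
by case: z => n; rewrite ?NegzE ?mulrNz ?dualN dualMn.
Qed.

End CharacterTheory.

(** * The pairing of the odometer with the rational group *)

Section Pairing.
Variables (R : realType) (l : nat -> option nat).

Lemma QvalD : {morph @Qval l : q r / q + r}.
Proof. exact: (raddfD (\val : Qgroup l -> rat)). Qed.

Lemma QvalMn (q : Qgroup l) (n : nat) : Qval (q *+ n) = Qval q *+ n.
Proof. exact: (raddfMn (\val : Qgroup l -> rat)). Qed.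

Lemma QvalMz (q : Qgroup l) (z : int) : Qval (q *~ z) = Qval q *~ z.
Proof. exact: (raddfMz (\val : Qgroup l -> rat)). Qed.

(** For fixed [k] this cuts out the cyclic group generated by [1/m_k], where [m_k] is [modulus l k].
    These groups increase with [k] and exhaust [Qgroup l]. *)
Definition annihilates (k : nat) (q : Qgroup l) : bool :=
  (modulus l k)%:R * Qval q \is a Num.int.

Lemma annihilates_ex (q : Qgroup l) : exists k, annihilates k q.
Proof.
have /asboolP/inQP[D [D0 qI Dl]] := valP q; exists D.
rewrite /annihilates -(divnK (dvdn_modulus_of_leq_ext D0 Dl)) natrM -mulrA.
by rewrite rpredM// rpred_nat.
Qed.

Lemma annihilates_leq (i j : nat) (q : Qgroup l) :
  (i <= j)%N -> annihilates i q -> annihilates j q.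
Proof.
move=> ij iq; rewrite /annihilates -(divnK (dvdn_modulus l ij)) natrM -mulrA.
by rewrite rpredM// rpred_nat.
Qed.

(** A choice made from [q] alone: for fixed [q] the pairing then depends on a single coordinate of
    the odometer, which yields continuity. *)
Definition level (q : Qgroup l) : nat := ex_minn (annihilates_ex q).

Lemma annihilates_level (q : Qgroup l) : annihilates (level q) q.
Proof. by rewrite /level; case: ex_minnP. Qed.

Lemma odometer_coherent (x : odometer l) (i j : nat) :
  (i <= j)%N -> Zreduce (modulus l i) (set_val x j) = set_val x i.
Proof. exact: (set_valP x). Qed.

Lemma expi2pi_congr (q : Qgroup l) (k : nat) (a b : int) : annihilates k q ->
  Zclass (modulus l k) a = Zclass (modulus l k) b ->
  expi2pi (ratr (Qval q * a%:~R) : R) = expi2pi (ratr (Qval q * b%:~R)).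
Proof.
move=> kq /eqP; rewrite Zclass_eq => /dvdzP[c cE]; apply/eq_expi2pi.
rewrite -rmorphB -mulrBr -intrB cE intrM mulrCA.
by apply/ratr_int_num/rpredM; rewrite ?intr_int// mulrC.
Qed.

Definition pairing (x : odometer l) (q : Qgroup l) : Cplx R :=
  expi2pi (ratr (Qval q * (repr (set_val x (level q)))%:~R)).

Lemma pairingE (x : odometer l) (q : Qgroup l) (k : nat) (a : int) :
  annihilates k q -> Zclass (modulus l k) a = set_val x k ->
  pairing x q = expi2pi (ratr (Qval q * a%:~R)).
Proof.
(* By coherence, integers representing coordinates [i <= j] agree modulo the smaller modulus, which
   already makes [q] integral. *)
have aux i j b c : (i <= j)%N -> annihilates i q ->
    Zclass (modulus l i) b = set_val x i -> Zclass (modulus l j) c = set_val x j ->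
    expi2pi (ratr (Qval q * b%:~R) : R) = expi2pi (ratr (Qval q * c%:~R)).
  move=> ij iq bE cE; apply: (expi2pi_congr iq).
  by rewrite bE -(odometer_coherent x ij) -cE Zreduce_class// dvdn_modulus.
move=> kq aE; have lE := Zclass_repr (set_val x (level q)).
case/orP: (leq_total k (level q)) => [kl|lk].
  exact/esym/(aux _ _ _ _ kl kq aE lE).
exact: (aux _ _ _ _ lk (annihilates_level q) lE aE).
Qed.

Lemma pairingD (x : odometer l) (q r : Qgroup l) :
  pairing x (q + r) = pairing x q * pairing x r.
Proof.
have [k [kq kr]] : exists k, annihilates k q /\ annihilates k r.
  exists (maxn (level q) (level r)).
  by split; apply: annihilates_leq (annihilates_level _);
    rewrite ?leq_maxl ?leq_maxr.
have kqr : annihilates k (q + r) by rewrite /annihilates QvalD mulrDr rpredD.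
have aE := Zclass_repr (set_val x k).
rewrite (pairingE kq aE) (pairingE kr aE) (pairingE kqr aE).
by rewrite QvalD mulrDl rmorphD expi2piD.
Qed.

Lemma pairing_repr (x : odometer l) (q : Qgroup l) :
  pairing x (repr (\pi_(QmodZ l) q)) = pairing x q.
Proof.
set s := repr _.
have sqI : s - q \in GRing.ZmodClosed.clone (Qgroup l) (@Zpred l) _.
  by rewrite idealrBE reprK.
(* The integer [s - q] is annihilated at level 0 already, and its pairing is the exponential of an
   integer. *)
rewrite -[s](subrK q) pairingD (@pairingE x (s - q) 0 (repr (set_val x 0%N))).
- rewrite (expi2pi_int (ratr_int_num _ _)) ?mul1r//.
  by rewrite rpredM ?intr_int.
- by rewrite /annihilates rpredM ?rpred_nat.
- exact: Zclass_repr.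
Qed.

Lemma pairing_subproof (x : odometer l) :
  characters R (QmodZ l) (fun q => pairing x (repr q)).
Proof.
split=> [q|q r]; first exact: norm_expi2pi.
by rewrite -{1}[q]reprK -{1}[r]reprK -raddfD pairing_repr pairingD.
Qed.

Definition pairing_char (x : odometer l) : dual R (QmodZ l) :=
  Character (pairing_subproof x).

(** Evaluation at a class factors through the projection to one discrete coordinate. *)
Lemma pairing_char_continuous : continuous pairing_char.
Proof.
apply: subtype_continuous; apply: prod_continuous => q x.
pose k := level (repr q).
apply: (@continuous_comp (odometer l) _ _ (fun y => set_val y k)
  (fun c : Zmod (modulus l k) =>
     expi2pi (ratr (Qval (repr q) * (repr c)%:~R)) : Cplx R)).
  apply: (@continuous_comp (odometer l)
    (prod_topology (fun k => Zmod (modulus l k))) (Zmod (modulus l k))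
    (@set_val _ _) (fun f => f k)).
    exact: initial_continuous.
  exact: (@proj_continuous nat (fun k => Zmod (modulus l k)) k).
exact: discrete_continuous.
Qed.

Lemma pairing_char_translate (x : odometer l) :
  pairing_char (translate 1 x) = mulchar (idchar R l) (pairing_char x).
Proof.
apply/val_inj/funext => q.
rewrite /= -[in LHS](reprK q) pairing_repr.
have aE := Zclass_repr (set_val x (level (repr q))).
(* If [a] represents a coordinate of [x], then [1 + a] represents that of the translate; the summand
   1 contributes the identity character. *)
rewrite (@pairingE (translate 1 x) _ _ (1 + repr (set_val x (level (repr q))))
  (annihilates_level (repr q))).
  rewrite -[RHS]/(idchar_fun R q * pairing x (repr q)).
  rewrite (pairingE (annihilates_level _) aE) intrD mulrDr mulr1 rmorphD.
  by rewrite expi2piD.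
by rewrite ZclassD aE addrC.
Qed.

(** * The generators [1/m_k] and injectivity *)

Lemma inv_modulus_subproof (k : nat) : (modulus l k)%:R^-1 \in Qpred l.
Proof.
apply/asboolP/inQP; exists (modulus l k); split; first exact: modulus_gt0.
  by rewrite mulfV ?rpred1// pnatr_eq0 -lt0n modulus_gt0.
exact: logn_modulus_leq_ext.
Qed.

Definition inv_modulus (k : nat) : Qgroup l := MkQgroup (inv_modulus_subproof k).

Lemma annihilates_inv_modulus (k : nat) : annihilates k (inv_modulus k).
Proof.
by rewrite /annihilates /= mulfV ?rpred1// pnatr_eq0 -lt0n modulus_gt0.
Qed.

Lemma expi2pi_modulus_inj (k : nat) (a b : int) :
  expi2pi (a%:~R / (modulus l k)%:R : R) = expi2pi (b%:~R / (modulus l k)%:R) ->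
  Zclass (modulus l k) a = Zclass (modulus l k) b.
Proof.
move=> /eq_expi2pi; rewrite -mulrBl -intrB divr_int_dvdz ?modulus_gt0//.
by rewrite -Zclass_eq => /eqP.
Qed.

Lemma ratr_inv_modulus (k : nat) (a : int) :
  ratr (Qval (inv_modulus k) * a%:~R) = a%:~R / (modulus l k)%:R :> R.
Proof. by rewrite rmorphM /= fmorphV /= ratr_int ratr_nat mulrC. Qed.

Lemma pairing_char_inj : injective pairing_char.
Proof.
move=> x y /(congr1 (@set_val _ _)) xy.
apply/val_inj/functional_extensionality_dep => k /=.
pose c := \pi_(QmodZ l) (inv_modulus k).
have : pairing x (repr c) = pairing y (repr c) := congr1 (fun f => f c) xy.
rewrite !pairing_repr.
rewrite !(pairingE (annihilates_inv_modulus k) (Zclass_repr _)) !ratr_inv_modulus.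
by move/expi2pi_modulus_inj; rewrite !Zclass_repr.
Qed.

(** * Characters on the cyclic subgroups and surjectivity *)

Lemma annihilatesE (k : nat) (q : Qgroup l) : annihilates k q ->
  exists z : int, q = inv_modulus k *~ z.
Proof.
case/intrP => z qE; exists z; apply/val_inj.
rewrite /= QvalMz /= -mulrzr -qE mulrC.
by rewrite mulrAC mulfV ?mul1r// pnatr_eq0 -lt0n modulus_gt0.
Qed.

Lemma pi_int_eq0 (q : Qgroup l) : Qval q \is a Num.int -> \pi_(QmodZ l) q = 0.
Proof.
move=> qI; rewrite -(raddf0 \pi_(QmodZ l)); apply/eqP.
by rewrite -idealrBE subr0.
Qed.

(** Such a [q] is an integer multiple of the generator [1/m_k], so the value of [chi] there is a
    power of its value at the generator. *)
Lemma dual_pi_annihilates (chi : dual R (QmodZ l)) (k : nat) (a : int)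
    (q : Qgroup l) :
  set_val chi (\pi_(QmodZ l) (inv_modulus k)) =
    expi2pi (a%:~R / (modulus l k)%:R) ->
  annihilates k q ->
  set_val chi (\pi_(QmodZ l) q) = expi2pi (ratr (Qval q * a%:~R)).
Proof.
move=> chiE /annihilatesE[z ->].
rewrite raddfMz dualMz chiE -ratr_inv_modulus -expi2piMz.
by rewrite QvalMz mulrzAl raddfMz.
Qed.

Lemma dual_inv_modulus (chi : dual R (QmodZ l)) (k : nat) : exists a : int,
  set_val chi (\pi_(QmodZ l) (inv_modulus k)) =
    expi2pi (a%:~R / (modulus l k)%:R).
Proof.
have [|a ->] := @root_of_unity_expi2pi R (modulus l k)
  (set_val chi (\pi_(QmodZ l) (inv_modulus k))) (modulus_gt0 l k).
  (* The multiple [m_k * (1/m_k) = 1] vanishes modulo the integers, so the value is an [m_k]-th root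
     of unity. *)
  rewrite -dualMn -(raddfMn \pi_(QmodZ l)) /= pi_int_eq0 ?dual0//.
  rewrite QvalMn -mulr_natl.
  exact: annihilates_inv_modulus.
by exists a%:Z.
Qed.

Lemma pairing_char_surj (chi : dual R (QmodZ l)) :
  exists x, pairing_char x = chi.
Proof.
have [a aE] := choice (dual_inv_modulus chi).
have xP : odometer_set (fun k => Zclass (modulus l k) (a k)).
  move=> i j ij; rewrite Zreduce_class ?dvdn_modulus//.
  (* Coherence: [1/m_i] is annihilated at levels [i] and [j], so [chi] there is computed from [a i]
     and from [a j]; equality of the two exponentials gives the congruence modulo [m_i]. *)
  apply: expi2pi_modulus_inj; rewrite -!ratr_inv_modulus.
  rewrite -(dual_pi_annihilates (aE i))//; last exact: annihilates_inv_modulus.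
  rewrite -(dual_pi_annihilates (aE j))//.
  exact: annihilates_leq ij (annihilates_inv_modulus i).
exists (Coherent xP); apply/val_inj/funext => q.
have kq := annihilates_level (repr q).
have := dual_pi_annihilates (aE _) kq; rewrite reprK => chiE.
exact: etrans (pairingE kq _) (esym chiE).
Qed.

End Pairing.

Theorem proposition6p9 (R : realType) (l : nat -> option nat) :
  ds_isomorphic (dual_system R l) (odometer_system l).
Proof.
have [h hh hK] := continuous_bij_homeo (@odometer_compact l)
  (@dual_hausdorff R (QmodZ l)) (@pairing_char_continuous R l)
  (@pairing_char_inj R l) (@pairing_char_surj R l).
(* Once [pairing_char] is applied, it cancels [h], and both sides become the product of the identity
   character and [chi]. *)
exists h => // chi; apply: (@pairing_char_inj R l).
by rewrite hK pairing_char_translate hK.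
Qed.
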